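(* Every finite metric space $(X,d)$ with $k\ge2$ terminals is $(4\log k)$-terminal-decomposable with concentration.
   Context: Let $(X,d)$ be a finite metric space with designated terminals $T=\{t_1,\dots,t_k\}\subseteq X$. A partial partition of $X$ is a collection of pairwise disjoint subsets of $X$. A shortest path between $x_0,x_\ell\in X$ is a sequence $P=(x_0,\dots,x_\ell)$ of points with $\sum_{i=1}^\ell d(x_{i-1},x_i)=d(x_0,x_\ell)$, of length $d(P)=d(x_0,x_\ell)$; $P$ meets $S$ if $S\cap P\ne\emptyset$; for a partial partition $\Pi$, $Z_P(\Pi)=\#\{S\in\Pi:P\text{ meets }S\}$. $X$ is $\beta$-terminal-decomposable with concentration if for every $\Delta>0$ there is a probability distribution $\mu$ over partial partitions of $X$ such that: (Diameter bound) for all $\Pi\in\mathrm{supp}(\mu)$ and $S\in\Pi$, $\mathrm{diam}(S)\le\Delta$; (Separation probability) for all $x,y\in X$, $\Pr_{\Pi\sim\mu}[\exists S\in\Pi\text{ with }|S\cap\{x,y\}|=1]\le\beta d(x,y)/\Delta$; (Terminal cover) for every $\Pi\in\mathrm{supp}(\mu)$, $T\subseteq\bigcup_{S\in\Pi}S$; (Degree of separation) there are absolute constants $C,c>0$ such that for every shortest path $P$ and every $t\ge1$, $$\Pr_{\Pi\sim\mu}\Big[Z_P>\tfrac{t\beta}{\Delta}\max\{d(P),\Delta/\beta\}\Big]\le C\min\Big\{k\beta,\Big\lceil\tfrac{d(P)\beta}{\Delta}\Big\rceil\Big\}e^{-ct}.$$ *)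

(* Defs.v *)
From mathcomp Require Import all_boot.
From Stdlib Require Import Reals.
Set Implicit Arguments. Unset Strict Implicit. Unset Printing Implicit Defensive.

Local Open Scope R_scope.

Definition is_metric (X : finType) (d : X -> X -> R) : Prop :=
  (forall x y, 0 <= d x y) /\
  (forall x y, d x y = 0 <-> x = y) /\
  (forall x y, d x y = d y x) /\
  (forall x y z, d x z <= d x y + d y z).

Definition partial_partition (X : finType) (Pi : {set {set X}}) : Prop :=
  trivIset Pi.

Definition diam_le (X : finType) (d : X -> X -> R) (S : {set X}) (Delta : R) : Prop :=
  forall x y, x \in S -> y \in S -> d x y <= Delta.

Fixpoint path_len (X : finType) (d : X -> X -> R) (x0 : X) (p : seq X) : R :=
  match p with
  | [::] => 0
  | x1 :: p' => d x0 x1 + path_len d x1 p'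
  end.

Definition shortest_path (X : finType) (d : X -> X -> R) (x0 : X) (p : seq X) : Prop :=
  path_len d x0 p = d x0 (last x0 p).

Definition sp_length (X : finType) (d : X -> X -> R) (x0 : X) (p : seq X) : R :=
  d x0 (last x0 p).

Definition Z_P (X : finType) (x0 : X) (p : seq X) (Pi : {set {set X}}) : nat :=
  #|[set S in Pi | has (fun x => x \in S) (x0 :: p)]|.

Definition is_distribution (X : finType) (mu : {set {set X}} -> R) : Prop :=
  (forall Pi, 0 <= mu Pi) /\
  \big[Rplus/0]_(Pi : {set {set X}}) mu Pi = 1.

Definition Rltb (a b : R) : bool := if Rlt_dec a b then true else false.

Definition prob (X : finType) (mu : {set {set X}} -> R) (E : pred {set {set X}}) : R :=
  \big[Rplus/0]_(Pi : {set {set X}} | E Pi) mu Pi.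

(* ceiling of a real: ceil x = - floor (- x), with floor y = up y - 1 *)
Definition Rceil (x : R) : R := IZR (1 - up (- x))%Z.

Definition separates (X : finType) (x y : X) (Pi : {set {set X}}) : bool :=
  [exists S in Pi, (x \in S) != (y \in S)].

(* X (with metric d and terminals T, k = #|T|) is beta-terminal-decomposable
   with concentration, with the absolute constants C, c given explicitly. *)
Definition terminal_decomposable_with_concentration_consts
  (X : finType) (d : X -> X -> R) (T : {set X}) (beta C c : R) : Prop :=
  forall Delta : R, 0 < Delta ->
  exists mu : {set {set X}} -> R,
    is_distribution mu /\
    (forall Pi, mu Pi <> 0 -> partial_partition Pi) /\
    (forall Pi, mu Pi <> 0 -> forall S, S \in Pi -> diam_le d S Delta) /\
    (forall x y : X, prob mu (separates x y) <= beta * d x y / Delta) /\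
    (forall Pi, mu Pi <> 0 -> T \subset cover Pi) /\
    (forall (x0 : X) (p : seq X), shortest_path d x0 p ->
       forall t : R, 1 <= t ->
       prob mu (fun Pi => Rltb
                   (t * beta / Delta * Rmax (sp_length d x0 p) (Delta / beta))
                   (INR (Z_P x0 p Pi)))
       <= C * Rmin (INR #|T| * beta) (Rceil (sp_length d x0 p * beta / Delta))
            * exp (- c * t)).

(* Main.v *)
Require Import Defs.
From mathcomp Require Import all_boot.
From Stdlib Require Import Reals Lra Classical.
From mathcomp Require Import Rstruct.

(* Carve balls around the terminals one after another, with independent radii:
   exponential of rate [4 ln k / Delta] truncated at [Delta / 2] (uniform if
   [k = 2]), the j-th cluster being the part of the j-th ball not yet covered.
   Separation: by memorylessness the j-th ball cuts [x, y] with probability at most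
   [kap] times the probability that it reaches the pair, plus a truncation error
   [kap'], and the reaching probabilities telescope over the terminals.
   Concentration: a ball reaching a set [A] of diameter [Delta / beta] swallows it
   with probability about 1/2, so [(3/2) ^ #clusters meeting A] has bounded
   expectation; a shortest path is cut into [ceil (d(P) beta / Delta)] such sets.

   Only the traces of the balls on the finite space matter, so a radius is
   represented by a point [x] (the ball around [t] having radius [d t x]) drawn with
   weights whose tail function is that of the continuous radius. *)

Set Implicit Arguments.
Unset Strict Implicit.
Unset Printing Implicit Defensive.

Local Open Scope R_scope.

Local Notation "\rsum_ ( i | P ) F" := (\big[Rplus/0]_(i | P%B) F)
  (at level 41, F at level 41, i at level 50).
Local Notation "\rsum_ i F" := (\big[Rplus/0]_i F)
  (at level 41, F at level 41, i at level 0).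

(** * Finite real sums and weights with a prescribed tail function *)

Definition indR (b : bool) : R := if b then 1 else 0.

Lemma indR_ge0 b : 0 <= indR b.
Proof. by case: b => /=; lra. Qed.

Lemma indR_le1 b : indR b <= 1.
Proof. by case: b => /=; lra. Qed.

Lemma rsum_ge0 (I : finType) (P : pred I) (F : I -> R) :
  (forall i, P i -> 0 <= F i) -> 0 <= \rsum_(i | P i) F i.
Proof. by move=> F0; apply: big_ind => // [|x y]; lra. Qed.

Lemma rsum_le (I : finType) (P : pred I) (F1 F2 : I -> R) :
  (forall i, P i -> F1 i <= F2 i) ->
  \rsum_(i | P i) F1 i <= \rsum_(i | P i) F2 i.
Proof. by move=> le12; apply: big_ind2 => //; [lra | move=> *; lra]. Qed.

Lemma rsum_ind (I : finType) (P : pred I) (F : I -> R) :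
  \rsum_(i | P i) F i = \rsum_i (F i * indR (P i)).
Proof.
by rewrite big_mkcond; apply: eq_bigr => i _; case: (P i) => /=; lra.
Qed.

Lemma exists_argmin (I : finType) (f : I -> R) (A : {set I}) (i0 : I) :
  i0 \in A -> exists2 m, m \in A & forall i, i \in A -> f m <= f i.
Proof.
have [n] := ubnP #|A|; elim: n A i0 => // n IHn A i0 leAn Ai0.
have [A0|[i1 Ai1]] := set_0Vmem (A :\ i0).
  exists i0 => // i Ai; have: i \notin A :\ i0 by rewrite A0 inE.
  by rewrite !inE Ai andbT negbK => /eqP->; lra.
have [|m] := IHn (A :\ i0) i1 _ Ai1.
  by move: leAn; rewrite (cardsD1 i0 A) Ai0.
rewrite !inE => /andP[_ Am] min_m.
have [le_m0|lt_0m] := Rle_lt_dec (f m) (f i0).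
  exists m => // i Ai; have [->//|ne] := eqVneq i i0.
  by apply: min_m; rewrite !inE ne.
exists i0 => // i Ai; have [->|ne] := eqVneq i i0; first lra.
by apply: Rle_trans (min_m i _); [lra | rewrite !inE ne].
Qed.

(** Induction that removes a point [m] of minimal [f]: once the others have their weights, [m] gets
    the difference between [G (f m)] and their total. That total is the tail at the smallest
    remaining value, so monotonicity of [G] makes the difference nonnegative. *)
Lemma exists_tail_weights (I : finType) (f : I -> R) (G : R -> R) :
  (forall a b, a <= b -> G b <= G a) -> (forall a, 0 <= G a) ->
  exists2 w : I -> R, forall i, 0 <= w i &
    forall i, \rsum_(j | Rleb (f i) (f j)) w j = G (f i).
Proof.
move=> Gdecr G0.
suff H (A : {set I}) : exists2 w : I -> R, forall i, 0 <= w i &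
    forall i, i \in A -> \rsum_(j | (j \in A) && Rleb (f i) (f j)) w j = G (f i).
  have [w w0 wE] := H setT; exists w => // i; rewrite -wE ?inE //.
  by apply: eq_bigl => j; rewrite inE.
have [n] := ubnP #|A|; elim: n A => // n IHn A leAn.
have [->|[i0 Ai0]] := set_0Vmem A.
  by exists (fun=> 0) => [i|i]; [lra | rewrite inE].
have [m Am min_m] := exists_argmin f Ai0.
have [|w w0 wE] := IHn (A :\ m); first by move: leAn; rewrite (cardsD1 m A) Am.
pose s := \rsum_(j | j \in A :\ m) w j.
have s_all i : i \in A :\ m -> f i <= f m -> s = G (f i).
  move=> Ai le_im; rewrite -wE //; apply: eq_bigl => j.
  case: (boolP (j \in _)) => //= Aj; symmetry; apply/RlebP.
  by have := min_m j; move: Aj; rewrite !inE => /andP[_ ->] /(_ isT); lra.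
have le_s : 0 <= s <= G (f m).
  split; first exact: rsum_ge0.
  rewrite /s; have [->|[i1 Ai1]] := set_0Vmem (A :\ m).
    by rewrite big_pred0 // => j; rewrite inE.
  have [m' Am' min_m'] := exists_argmin f Ai1.
  have -> : \rsum_(j | j \in A :\ m) w j = G (f m').
    rewrite -wE //; apply: eq_bigl => j.
    case: (boolP (j \in _)) => //= Aj; symmetry; apply/RlebP.
    exact: min_m'.
  by apply: Gdecr; apply: min_m; move: Am'; rewrite !inE => /andP[].
exists (fun i => if i == m then G (f m) - s else w i) => [i|i Ai].
  by case: eqP => // _; lra.
(* A point tied with [m] has all of [A] as its tail; the tail of a point strictly above [m] does not
   contain [m]. *)
have [le_im|lt_mi] := Rle_lt_dec (f i) (f m).
  rewrite (bigD1 m) ?eqxx /=; last by rewrite Am; apply/RlebP.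
  have -> : \rsum_(j | ((j \in A) && Rleb (f i) (f j)) && (j != m))
              (if j == m then G (f m) - s else w j) = s.
    rewrite /s; apply: eq_big => [j|j /andP[_ /negPf->]//].
    rewrite !inE andbC; case: eqP => //= _; case: (boolP (j \in A)) => //= Aj.
    by apply/RlebP; have := min_m _ Aj; lra.
  have -> : f i = f m by have := min_m _ Ai; lra.
  lra.
have Ai' : i \in A :\ m.
  by rewrite !inE Ai andbT; apply/eqP => eim; move: lt_mi; rewrite eim; lra.
rewrite -(wE i Ai'); apply: eq_big => [j|j]; last first.
  by case: eqP => // -> /andP[_ /RlebP]; lra.
rewrite !inE; case: eqP => //= ->; apply/andP => -[_ /RlebP]; lra.
Qed.

(** * Sequential carving of balls and the law of the resulting partial partition *)

Section Carving.

Variables (X : finType) (ball : X -> X -> {set X}) (w : X -> X -> R).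

(** The possible outcomes: [U] holds the points not yet covered, and a cluster may be empty. The
    weights are ignored, so every [x] is allowed as a radius. *)
Fixpoint carved (ts : seq X) (U : {set X}) (Pi : {set {set X}}) : Prop :=
  if ts is t :: ts' then
    exists x Pi', Pi = (U :&: ball t x) |: Pi' /\ carved ts' (U :\: ball t x) Pi'
  else Pi = set0.

(** The expectation of [F] over independent radii, as nested sums: unfolding one level conditions on
    the first radius, which is what the inductions over the terminals use. *)
Fixpoint Ecarve (ts : seq X) (U : {set X}) (F : {set {set X}} -> R) : R :=
  if ts is t :: ts' then
    \rsum_x (w t x *
      Ecarve ts' (U :\: ball t x) (fun Pi => F ((U :&: ball t x) |: Pi)))
  else F set0.

Lemma carved_sub ts U Pi S : carved ts U Pi -> S \in Pi -> S \subset U.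
Proof.
elim: ts U Pi => [|t ts IH] U Pi /=; first by move=> ->; rewrite inE.
move=> [x [Pi' [-> cPi']]]; rewrite !inE => /orP[/eqP->|/(IH _ _ cPi')].
  exact: subsetIl.
by move=> /subset_trans; apply; apply: subsetDl.
Qed.

Lemma carved_trivIset ts U Pi : carved ts U Pi -> trivIset Pi.
Proof.
elim: ts U Pi => [|t ts IH] U Pi /=.
  by move=> ->; apply/trivIsetP => A B; rewrite inE.
move=> [x [Pi' [-> cPi']]].
have disj B : B \in Pi' -> [disjoint U :&: ball t x & B].
  move=> /(carved_sub cPi') /subsetP sB; apply/pred0P => y /=.
  apply/negP => /andP[]; rewrite inE => /andP[_ yb] /sB.
  by rewrite inE yb.
have /trivIsetP tPi' := IH _ _ cPi'.
apply/trivIsetP => A B; rewrite !inE.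
case/orP=> [/eqP->|PA]; case/orP=> [/eqP->|PB] neAB; first by rewrite eqxx in neAB.
- exact: disj.
- by rewrite disjoint_sym; apply: disj.
- exact: tPi'.
Qed.

Lemma carved_card ts U Pi : carved ts U Pi -> (#|Pi| <= size ts)%nat.
Proof.
elim: ts U Pi => [|t ts IH] U Pi /=; first by move=> ->; rewrite cards0.
move=> [x [Pi' [-> cPi']]]; rewrite cardsU1 -(add1n (size ts)).
by apply: leq_add (IH _ _ cPi'); case: (_ \notin _).
Qed.

Lemma carved_sub_ball ts U Pi S : carved ts U Pi -> S \in Pi ->
  exists t x, S \subset ball t x.
Proof.
elim: ts U Pi => [|t ts IH] U Pi /=; first by move=> ->; rewrite inE.
move=> [x [Pi' [-> cPi']]]; rewrite !inE => /orP[/eqP->|/(IH _ _ cPi')//].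
by exists t, x; apply: subsetIr.
Qed.

(** A terminal missed by all earlier balls is covered by its own ball when its turn comes. *)
Lemma carved_cover ts U Pi t : (forall x, t \in ball t x) ->
  carved ts U Pi -> t \in ts -> t \in U -> t \in cover Pi.
Proof.
move=> tb; elim: ts U Pi => [|t' ts IH] U Pi //= [x [Pi' [-> cPi']]] tts tU.
rewrite /cover bigcup_setU big_set1 inE.
case: (boolP (t \in ball t' x)) => [tb'|tNb]; first by rewrite inE tU tb'.
apply/orP; right; apply: (IH _ _ cPi'); last by rewrite inE tNb.
by move: tts; rewrite inE => /predU1P[ett|//]; rewrite -ett tb in tNb.
Qed.

Hypothesis w_ge0 : forall t x, 0 <= w t x.

Lemma Ecarve_le ts U F1 F2 :
  (forall Pi, carved ts U Pi -> F1 Pi <= F2 Pi) ->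
  Ecarve ts U F1 <= Ecarve ts U F2.
Proof.
elim: ts U F1 F2 => [|t ts IH] U F1 F2 le12 /=; first exact: le12.
apply: rsum_le => x _; apply: Rmult_le_compat_l => //.
by apply: IH => Pi cPi; apply: le12; exists x, Pi.
Qed.

Lemma eq_Ecarve ts U F1 F2 :
  (forall Pi, carved ts U Pi -> F1 Pi = F2 Pi) ->
  Ecarve ts U F1 = Ecarve ts U F2.
Proof.
by move=> e12; apply: Rle_antisym; apply: Ecarve_le => Pi /e12->; lra.
Qed.

Lemma EcarveZ ts U a F : Ecarve ts U (fun Pi => a * F Pi) = a * Ecarve ts U F.
Proof.
elim: ts U F => [|t ts IH] U F //=; rewrite big_distrr /=.
by apply: eq_bigr => x _; rewrite IH; lra.
Qed.

Lemma Ecarve_sum (I : finType) (P : pred I) ts U (F : I -> {set {set X}} -> R) :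
  Ecarve ts U (fun Pi => \rsum_(i | P i) F i Pi) =
  \rsum_(i | P i) Ecarve ts U (F i).
Proof.
elim: ts U F => [|t ts IH] U F //=; rewrite exchange_big /=.
by apply: eq_bigr => x _; rewrite IH big_distrr.
Qed.

Hypothesis w_sum1 : forall t, \rsum_x w t x = 1.

Lemma Ecarve_const ts U a : Ecarve ts U (fun=> a) = a.
Proof.
elim: ts U => [|t ts IH] U //=; under eq_bigr do rewrite IH.
by rewrite -big_distrl w_sum1 /=; lra.
Qed.

Definition carve_dist ts (Pi : {set {set X}}) : R :=
  Ecarve ts setT (fun Pi' => indR (Pi' == Pi)).

Lemma prob_carve_dist ts E :
  prob (carve_dist ts) E = Ecarve ts setT (fun Pi => indR (E Pi)).
Proof.
rewrite /prob -Ecarve_sum; apply: eq_Ecarve => Pi _.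
rewrite big_mkcond (bigD1 Pi) //= big1 => [|Pi' /negPf neq].
  by rewrite eqxx; case: (E Pi) => /=; lra.
by rewrite eq_sym neq; case: ifP.
Qed.

Lemma carve_distP ts : is_distribution (carve_dist ts).
Proof.
split=> [Pi|].
  rewrite -[0](Ecarve_const ts setT); apply: Ecarve_le => Pi' _.
  exact: indR_ge0.
have := prob_carve_dist ts predT.
by rewrite /= Ecarve_const.
Qed.

(** If [Pi] is not an outcome, the indicator in [carve_dist] vanishes on every outcome, and so does
    its expectation. *)
Lemma carve_dist_supp ts Pi : carve_dist ts Pi <> 0 -> carved ts setT Pi.
Proof.
move=> muPi; apply: NNPP => NcPi; apply: muPi.
rewrite -[0](Ecarve_const ts setT); apply: eq_Ecarve => Pi' cPi' /=.
by case: eqP => // ePi; case: NcPi; rewrite -ePi.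
Qed.

End Carving.

(** * Counting the clusters that meet a set *)

(** Extends [Z_P] from paths to sets, so that a path can be cut into pieces. Empty clusters never
    count. *)
Definition hits (X : finType) (A : {set X}) (Pi : {set {set X}}) : nat :=
  #|[set S in Pi | ~~ [disjoint S & A]]|.

Lemma Z_P_hits (X : finType) (x0 : X) p Pi : Z_P x0 p Pi = hits [set:: x0 :: p] Pi.
Proof.
rewrite /Z_P /hits; apply: eq_card => S; rewrite !inE; congr (_ && _).
apply/hasP/pred0Pn => [[x xp xS]|[x /andP[/= xS]]].
  by exists x; rewrite /= xS /= inE.
by rewrite inE => xp; exists x.
Qed.

Lemma hits_card (X : finType) (A : {set X}) Pi : (hits A Pi <= #|Pi|)%nat.
Proof. by apply: subset_leq_card; apply/subsetP => S; rewrite inE => /andP[]. Qed.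

Lemma hits_set0 (X : finType) (A : {set X}) : hits A set0 = 0%nat.
Proof. by apply/eqP; rewrite -leqn0 -(cards0 {set X}) hits_card. Qed.

(** Only an inequality, since [S] may already belong to [Pi]. *)
Lemma hitsU1 (X : finType) (A : {set X}) S Pi :
  (hits A (S |: Pi) <= ~~ [disjoint S & A] + hits A Pi)%nat.
Proof.
rewrite /hits; case: (boolP [disjoint S & A]) => dSA /=.
  apply: subset_leq_card; apply/subsetP => S'; rewrite !inE.
  by case: eqP => [->|_]; rewrite ?dSA // andbF.
apply: (leq_trans (n := #|S |: [set S' in Pi | ~~ [disjoint S' & A]]|)).
  apply: subset_leq_card; apply/subsetP => S'; rewrite !inE.
  by case: eqP.
by rewrite cardsU1; apply: leq_add => //; case: (_ \notin _).
Qed.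

Lemma hits_bigcup (X I : finType) (A : {set X}) (B : I -> {set X}) Pi :
  A \subset \bigcup_i B i -> (hits A Pi <= \sum_i hits (B i) Pi)%nat.
Proof.
move=> /subsetP sAB; rewrite /hits.
apply: leq_trans (_ : #|\bigcup_i [set S in Pi | ~~ [disjoint S & B i]]| <= _)%nat.
  apply: subset_leq_card; apply/subsetP => S; rewrite !inE => /andP[SPi].
  case/pred0Pn => x /andP[/= xS /sAB /bigcupP[i _ xB]].
  apply/bigcupP; exists i => //; rewrite inE SPi /=.
  by apply/pred0Pn; exists x; rewrite /= xS.
apply: (big_ind2 (fun (C : {set {set X}}) n => (#|C| <= n)%nat)) => //.
  by rewrite cards0.
move=> C1 n1 C2 n2 le1 le2; apply: leq_trans (leq_add le1 le2).
by rewrite cardsU leq_subr.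
Qed.

Lemma carved_hits_outside (X : finType) (ball : X -> X -> {set X}) ts U Pi A :
  carved ball ts U Pi -> A :&: U = set0 -> hits A Pi = 0%nat.
Proof.
move=> cPi AU0; rewrite /hits; apply/eqP; rewrite cards_eq0 -subset0.
apply/subsetP => S; rewrite !inE => /andP[/(carved_sub cPi)/subsetP sSU].
case/pred0Pn => x /andP[/= /sSU xU xA].
by have := in_set0 x; rewrite -AU0 inE xA xU.
Qed.

Lemma carved_separates_outside (X : finType) (ball : X -> X -> {set X}) ts U Pi x y :
  carved ball ts U Pi -> x \notin U -> y \notin U -> separates x y Pi = false.
Proof.
move=> cPi xU yU; apply/existsP => -[S /andP[/(carved_sub cPi)/subsetP sSU]].
by rewrite (contraNF (sSU x) xU) (contraNF (sSU y) yU).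
Qed.

Lemma separatesU1 (X : finType) (x y : X) S Pi :
  separates x y (S |: Pi) = ((x \in S) != (y \in S)) || separates x y Pi.
Proof.
apply/existsP/orP => [[S' /andP[]]|].
  rewrite !inE => /orP[/eqP->|S'Pi] sep; first by left.
  by right; apply/existsP; exists S'; rewrite S'Pi.
case=> [sep|/existsP[S' /andP[S'Pi sep]]].
  by exists S; rewrite !inE eqxx.
by exists S'; rewrite !inE S'Pi orbT.
Qed.

(** * Separation probability and exponential moment, by induction over the terminals *)

Section Bounds.

Variables (X : finType) (d : X -> X -> R) (ball : X -> X -> {set X}).
Variables (w : X -> X -> R) (G : R -> R).

Hypothesis d_metric : is_metric d.
Hypothesis G_decr : forall a b, a <= b -> G b <= G a.
Hypothesis G_ge0 : forall a, 0 <= G a.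
Hypothesis G0 : G 0 = 1.
Hypothesis ball_down : forall t x y z, d t z <= d t y -> y \in ball t x -> z \in ball t x.
Hypothesis ball_center : forall t x, t \in ball t x.
Hypothesis w_ge0 : forall t x, 0 <= w t x.
Hypothesis w_tail : forall t y, \rsum_(x | y \in ball t x) w t x = G (d t y).

(** A center lies in all its balls, so the tail at distance 0 is the total weight. *)
Lemma weights_sum1 t : \rsum_x w t x = 1.
Proof.
have [_ [/(_ t t) [_ dtt] _]] := d_metric.
rewrite -G0 -[in RHS](dtt erefl) -w_tail.
by apply: eq_bigl => x; rewrite ball_center.
Qed.

(* [A] is hit exactly when its point nearest to [t] is covered and swallowed
   exactly when its farthest point is; [a] and [s] are the distance of the former
   and the probability of covering the latter. *)
Lemma ball_step t (A : {set X}) del c1 c2 c3 (h : X -> R) :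
  A != set0 -> (forall x y, x \in A -> y \in A -> d x y <= del) ->
  (forall x, [disjoint ball t x & A] -> h x <= c1) ->
  (forall x, A \subset ball t x -> h x <= c2) ->
  (forall x, h x <= c3) ->
  exists a s, [/\ 0 <= a, 0 <= s, s <= G a, G (a + del) <= s &
    \rsum_x (w t x * h x) <= (1 - G a) * c1 + s * c2 + (G a - s) * c3].
Proof.
have [d0 [_ [dC dT]]] := d_metric.
move=> /set0Pn[i0 Ai0] diamA h1 h2 h3.
have [y0 Ay0 min0] := exists_argmin (d t) Ai0.
have [y1 Ay1 max1] := exists_argmin (fun y => - d t y) Ai0.
have le01 : d t y0 <= d t y1 by exact: min0.
exists (d t y0), (G (d t y1)); split=> //.
- exact: G_decr.
- by apply: G_decr; have := dT t y0 y1; have := diamA _ _ Ay0 Ay1; lra.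
rewrite -(w_tail t y0) -(w_tail t y1) !(rsum_ind (fun x => _ \in ball t x)).
(* A ball covering [y1] also covers [y0], so the three cases are encoded by two indicators, whose
   means are the two tails. *)
apply: (@Rle_trans _ (\rsum_x (w t x * (c1 + indR (y0 \in ball t x) * (c3 - c1)
    + indR (y1 \in ball t x) * (c2 - c3))))).
  apply: rsum_le => x _; apply: Rmult_le_compat_l => //.
  have [b1|Nb1] := boolP (y1 \in ball t x).
    rewrite (ball_down le01 b1) /=.
    suff /h2 : A \subset ball t x by lra.
    by apply/subsetP => y Ay; apply: ball_down b1; have := max1 _ Ay; lra.
  have [b0|Nb0] := boolP (y0 \in ball t x) => /=; first by have := h3 x; lra.
  suff /h1 : [disjoint ball t x & A] by lra.
  apply/pred0P => y; apply/negP => /andP[/= yb Ay].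
  by move/negP: Nb0; apply; apply: ball_down yb; apply: min0.
apply: Req_le.
transitivity (\rsum_x (w t x * c1 + (w t x * indR (y0 \in ball t x) * (c3 - c1) +
   w t x * indR (y1 \in ball t x) * (c2 - c3)))).
  by apply: eq_bigr => x _; ring.
rewrite !big_split /= -!big_distrl /= weights_sum1.
ring.
Qed.

(** The first ball either misses the pair (inductive bound), swallows it (0, nothing of it remains
    to be cut) or cuts it (at most 1). Cutting costs [kap * G a + kap'], and the mass [G a] removed
    from the inductive bound pays for [kap * G a]; only [kap'] accumulates. *)
Lemma separation_bound kap kap' x y ts (U : {set X}) :
  0 <= kap -> 0 <= kap' ->
  (forall a, 0 <= a -> G a - G (a + d x y) <= kap * G a + kap') ->
  x \in U -> y \in U ->
  Ecarve ball w ts U (fun Pi => indR (separates x y Pi)) <= kap + INR (size ts) * kap'.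
Proof.
move=> kap0 kap'0 Gcut.
have [d0 [d00 [dC dT]]] := d_metric.
have dxx z : d z z = 0 by apply/d00.
elim: ts U => [|t ts IH] U xU yU.
  have sep0 : separates x y set0 = false by apply/existsP => -[S]; rewrite inE.
  by rewrite /Ecarve sep0 /=; lra.
rewrite [Ecarve _ _ _ _ _]/=.
have [|||||a [s [a0 s0 sG Gs le]]] := @ball_step t [set x; y] (d x y)
  (kap + INR (size ts) * kap') 0 1 (fun z => Ecarve ball w ts (U :\: ball t z)
     (fun Pi => indR (separates x y ((U :&: ball t z) |: Pi)))).
- by apply/set0Pn; exists x; rewrite !inE eqxx.
- move=> u v; rewrite !inE => /orP[]/eqP-> /orP[]/eqP->; rewrite ?dxx ?(dC y x);
    by have := d0 x y; lra.
- move=> z /pred0P dis.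
  have xNb : x \notin ball t z.
    by apply/negP => xb; have := dis x; rewrite /= xb !inE eqxx.
  have yNb : y \notin ball t z.
    by apply/negP => yb; have := dis y; rewrite /= yb !inE eqxx orbT.
  apply: Rle_trans (IH (U :\: ball t z) _ _); rewrite ?inE ?xU ?xNb ?yU ?yNb //.
  apply: Ecarve_le => // Pi _; rewrite separatesU1 !inE (negPf xNb) (negPf yNb).
  by rewrite !andbF eqxx /=; lra.
- move=> z /subsetP sub.
  have xb : x \in ball t z by apply: sub; rewrite !inE eqxx.
  have yb : y \in ball t z by apply: sub; rewrite !inE eqxx orbT.
  rewrite -[X in _ <= X](Ecarve_const ball weights_sum1 ts (U :\: ball t z)).
  apply: Ecarve_le => // Pi cPi; rewrite separatesU1 !inE xU yU xb yb eqxx /=.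
  by rewrite (carved_separates_outside cPi) ?inE ?xb ?yb //=; lra.
- move=> z; rewrite -[X in _ <= X](Ecarve_const ball weights_sum1 ts (U :\: ball t z)).
  by apply: Ecarve_le => // Pi _; apply: indR_le1.
apply: Rle_trans le _.
have := Gcut _ a0; have := G_ge0 a.
have : G a <= 1 by rewrite -G0; apply: G_decr.
have := pos_INR (size ts).
rewrite [size (t :: ts)]/= S_INR; set n := INR _ => n0 p1 p0 cut.
have : 0 <= n * kap' by apply: Rmult_le_pos.
have : 0 <= G a * (n * kap').
  by apply: Rmult_le_pos => //; apply: Rmult_le_pos.
nra.
Qed.

(** Up to the error [q], at least half of the balls reaching [A] swallow what is left of it and end
    with a factor 3/2; the others multiply the inductive bound by 3/2. The constant 3 is the fixed
    point of [b = 3/4 + 3/4 * b], and [q] costs a factor [1 + 3 * q / 4] per terminal. *)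
Lemma hits_moment_bound q del (A : {set X}) ts U :
  0 <= q -> (forall x y, x \in A -> y \in A -> d x y <= del) ->
  (forall a, 0 <= a -> G a - G (a + del) <= (G a + q) / 2) ->
  Ecarve ball w ts U (fun Pi => (3 / 2) ^ hits A Pi) <= 3 * (1 + 3 * q / 4) ^ size ts.
Proof.
move=> q0 diamA Gcut.
have Phi n : 3 <= 3 * (1 + 3 * q / 4) ^ n.
  by have := pow_R1_Rle (1 + 3 * q / 4) n; lra.
elim: ts U => [|t ts IH] U; first by rewrite /= hits_set0 /=; lra.
have [AU0|AU] := eqVneq (A :&: U) set0.
  apply: Rle_trans (_ : 1 <= _); last by have := Phi (size (t :: ts)); lra.
  rewrite -[X in _ <= X](Ecarve_const ball weights_sum1 (t :: ts) U).
  apply: Ecarve_le => // Pi cPi; rewrite (carved_hits_outside cPi AU0) /=; lra.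
rewrite [Ecarve _ _ _ _ _]/=.
set B := 3 * (1 + 3 * q / 4) ^ size ts.
have IHU (z : X) : Ecarve ball w ts (U :\: ball t z)
     (fun Pi => (3/2) ^ hits A ((U :&: ball t z) |: Pi)) <= 3 / 2 * B.
  apply: Rle_trans (_ : Ecarve ball w ts (U :\: ball t z)
     (fun Pi => 3/2 * (3/2) ^ hits A Pi) <= _); last first.
    by rewrite EcarveZ; have := IH (U :\: ball t z); rewrite -/B; lra.
  apply: Ecarve_le => // Pi _.
  rewrite -[X in _ <= X]/((3/2) ^ (hits A Pi).+1).
  apply: Rle_pow; first lra.
  by apply/leP; apply: leq_trans (hitsU1 _ _ _) _; case: (~~ _); rewrite // add0n.
have [|||||a [s [a0 s0 sG Gs le]]] := @ball_step t (A :&: U) del B (3 / 2) (3 / 2 * B)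
  (fun z => Ecarve ball w ts (U :\: ball t z)
     (fun Pi => (3/2) ^ hits A ((U :&: ball t z) |: Pi))).
- exact: AU.
- by move=> u v; rewrite !inE => /andP[uA _] /andP[vA _]; apply: diamA.
- move=> z /pred0P dis; apply: Rle_trans (IH (U :\: ball t z)).
  apply: Ecarve_le => // Pi _; apply: Rle_pow; first lra.
  apply/leP; apply: leq_trans (hitsU1 _ _ _) _.
  suff -> : [disjoint U :&: ball t z & A] by [].
  apply/pred0P => y; have := dis y; rewrite /= !inE.
  by case: (y \in U); case: (y \in A); rewrite ?andbF ?andbT.
- move=> z /subsetP sub.
  rewrite -[X in _ <= X](Ecarve_const ball weights_sum1 ts (U :\: ball t z)).
  apply: Ecarve_le => // Pi cPi.
  rewrite -[X in _ <= X]pow_1; apply: Rle_pow; first lra.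
  apply/leP; apply: leq_trans (hitsU1 _ _ _) _.
  rewrite (carved_hits_outside cPi) ?addn0; first by case: (~~ _).
  apply/setP => y; rewrite !inE; apply/negP => /and3P[yA yNb yU].
  by move/negP: yNb; apply; apply: sub; rewrite inE yA.
- exact: IHU.
apply: Rle_trans le _.
have -> : 3 * (1 + 3 * q / 4) ^ size (t :: ts) = (1 + 3 * q / 4) * B.
  by rewrite /B /=; ring.
have := Gcut _ a0; have := G_ge0 a; have := Phi (size ts); rewrite -/B.
have : 0 <= 3 / 4 * q by lra.
(* The bound decreases in [s] with slope [3/2 * (B - 1)], so the slack of [Gcut] is multiplied by
   that slope; what remains is controlled by [G a * (B - 3) >= 0]. *)
move=> q1 B3 p0 cut; have := Rmult_le_pos _ _ p0 (_ : 0 <= B - 3).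
have : 0 <= (s - G a + (G a + q) / 2) * (3/2 * (B - 1)).
  by apply: Rmult_le_pos; lra.
move=> H1 H2; have {}H2 := H2 ltac:(lra).
nra.
Qed.

End Bounds.

Lemma rsum_const (I : finType) a : \big[Rplus/0]_(i : I) a = INR #|I| * a.
Proof.
rewrite big_const cardT; elim: (size _) => [|n IH] /=; first lra.
by rewrite IH -/(INR n.+1) S_INR; lra.
Qed.

(** Disjoint clusters cannot share [x]. This serves paths of length zero, which consist of a single
    point. *)
Lemma carved_hits1 (X : finType) (ball : X -> X -> {set X}) ts U Pi x :
  carved ball ts U Pi -> (hits [set x] Pi <= 1)%nat.
Proof.
move=> /carved_trivIset/trivIsetP tPi; apply/card_le1_eqP => S S'.
rewrite !inE => /andP[SPi /pred0Pn[y /andP[/= yS]]]; rewrite inE => /eqP <-.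
move=> /andP[S'Pi /pred0Pn[z /andP[/= zS']]]; rewrite inE => /eqP ezy.
apply/eqP/negPn/negP => neS.
have /pred0P dis := tPi S' S S'Pi SPi neS.
by have := dis y; rewrite /= yS -ezy zS'.
Qed.

(** * Geometry of shortest paths *)

Section ShortestPaths.

Variables (X : finType) (d : X -> X -> R).
Hypothesis d_metric : is_metric d.

(** The triangle inequality for the parts of the path before and after [y]. *)
Lemma path_len_ge (x0 : X) (p : seq X) (y : X) : y \in x0 :: p ->
  d x0 y + d y (last x0 p) <= path_len d x0 p.
Proof.
have [d0 [d00 [dC dT]]] := d_metric.
have dxx z : d z z = 0 by apply/d00.
have len_ge u q : d u (last u q) <= path_len d u q.
  elim: q u => [|v q IH] u /=; first by rewrite dxx; lra.
  by have := IH v; have := dT u v (last v q); lra.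
elim: p x0 => [|x1 p IH] x0.
  by rewrite inE => /eqP->; rewrite /= dxx; lra.
rewrite inE => /predU1P[->|yp]; first by rewrite dxx; have := len_ge x0 (x1 :: p); rewrite /=; lra.
by rewrite /=; have := IH _ yp; have := dT x0 x1 y; lra.
Qed.

Lemma shortest_path_behead x0 x1 p :
  shortest_path d x0 (x1 :: p) -> shortest_path d x1 p.
Proof.
have [d0 [d00 [dC dT]]] := d_metric; rewrite /shortest_path /= => sp.
have := path_len_ge (mem_head x1 p); have [_ /(_ erefl)->] := d00 x1 x1.
by have := dT x0 x1 (last x1 p); lra.
Qed.

(** The distance from [x0] embeds a shortest path isometrically into the line, so cutting the path
    by this distance gives pieces of controlled diameter. *)
Lemma shortest_path_isometric (x0 : X) (p : seq X) (y z : X) :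
  shortest_path d x0 p -> y \in x0 :: p -> z \in x0 :: p ->
  d y z = Rabs (d x0 y - d x0 z).
Proof.
have [d0 [d00 [dC dT]]] := d_metric.
have dxx u : d u u = 0 by apply/d00.
elim: p x0 => [|x1 p IH] x0 sp.
  by rewrite !inE => /eqP-> /eqP->; rewrite dxx Rminus_diag Rabs_R0.
(* On a shortest path the triangle inequalities have no slack. *)
have split (u : X) : u \in x1 :: p -> d x0 u = d x0 x1 + d x1 u.
  move=> up; have := path_len_ge up; have := dT x0 u (last x1 p); have := dT x0 x1 u.
  by move: sp; rewrite /shortest_path /=; lra.
rewrite inE => /predU1P[->|yp].
  by move=> _; rewrite dxx Rminus_0_l Rabs_Ropp Rabs_pos_eq.
rewrite inE => /predU1P[->|zp].
  by rewrite dxx Rminus_0_r Rabs_pos_eq // dC.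
rewrite (split _ yp) (split _ zp) (IH x1 (shortest_path_behead sp)) //.
by congr Rabs; ring.
Qed.

Lemma shortest_path_le (x0 : X) (p : seq X) (y : X) :
  shortest_path d x0 p -> y \in x0 :: p -> d x0 y <= sp_length d x0 p.
Proof.
have [d0 _] := d_metric; rewrite /sp_length => <- /path_len_ge.
by have := d0 y (last x0 p); lra.
Qed.

End ShortestPaths.

(** * Ceilings, unit segments and numerical bounds *)

Lemma Rceil_bound x : x <= Rceil x < x + 1.
Proof. by rewrite /Rceil minus_IZR; have := archimed (- x); lra. Qed.

Lemma Rceil_INR x : 0 <= x -> exists n, Rceil x = INR n.
Proof.
move=> x0; have [|n en] := IZN (1 - up (- x)).
  by apply: le_IZR; have := Rceil_bound x; rewrite /Rceil; lra.
by exists n; rewrite /Rceil en -INR_IZR_INZ.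
Qed.

(** The segments are closed at both ends, so [r = INR N] falls into the last one. *)
Lemma unit_segment N r : (0 < N)%nat -> 0 <= r <= INR N ->
  exists i : 'I_N, INR i <= r <= INR i + 1.
Proof.
elim: N => // N IH _ [r0 rN].
have [le_Nr|lt_rN] := Rle_lt_dec (INR N) r.
  by exists ord_max => /=; rewrite -S_INR.
have N0 : (0 < N)%nat.
  by rewrite lt0n; apply/eqP => N0; move: lt_rN; rewrite N0 /=; lra.
have [|i ri] := IH N0; first lra.
by exists (widen_ord (leqnSn N) i).
Qed.

Lemma exp_le x y : x <= y -> exp x <= exp y.
Proof. by case=> [/exp_increasing|->]; lra. Qed.

Lemma ln_le x y : 0 < x -> x <= y -> ln x <= ln y.
Proof. by move=> x0 [/(ln_increasing _ _ x0)|->]; lra. Qed.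

Lemma four_log2_ge4 k : (2 <= k)%nat -> 4 <= 4 * (ln (INR k) / ln 2).
Proof.
move=> k2; have l2 : 0 < ln 2 by have := ln_lt_2; lra.
suff : 1 <= ln (INR k) / ln 2 by lra.
apply: (Rmult_le_reg_r (ln 2)) => //; rewrite /Rdiv Rmult_assoc Rinv_l; last lra.
have -> : 1 * ln 2 = ln (INR 2) by rewrite Rmult_1_l.
rewrite Rmult_1_r; apply: ln_le; first by rewrite /=; lra.
by apply: le_INR; apply/leP.
Qed.

(** From [exp (1 / 11) >= 12 / 11] and [(12 / 11) ^ 8 >= 2]. The value is the inverse of
    [1 + 3 / 8], the factor by which truncation may inflate the separation rate when [k >= 3]. *)
Lemma ln2_le : ln 2 <= 8 / 11.
Proof.
have e : 12 / 11 <= exp (1 / 11) by have := exp_ineq1_le (1 / 11); lra.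
have e8 : (12 / 11) ^ 8 <= exp (8 / 11).
  have -> : 8 / 11 = INR 8 * (1 / 11) by rewrite /=; field.
  rewrite -[X in _ <= exp (_ * X)](ln_exp) -/(Rpower _ _) Rpower_pow; last exact: exp_pos.
  by apply: pow_incr; lra.
rewrite -[X in _ <= X]ln_exp; apply: ln_le; first lra.
apply: Rle_trans e8; lra.
Qed.

(** * The tail function of the radius *)

(** Where [G] is positive, [G + / (K - 1)] is a pure exponential, which loses the fraction
    [1 - exp (- (lam * del))] over a length [del]. Truncation at 0 only raises [G (a + del)], and
    where [G a = 0] the left side is at most 0. *)
Lemma exp_profile_cut K lam a del : 1 < K -> 0 <= lam -> 0 <= del ->
  let G r := Rmax 0 ((K * exp (- (lam * r)) - 1) / (K - 1)) in
  G a - G (a + del) <= (G a + / (K - 1)) * (1 - exp (- (lam * del))).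
Proof.
move=> K1 lam0 del0 G.
have eD : exp (- (lam * (a + del))) = exp (- (lam * a)) * exp (- (lam * del)).
  by rewrite -exp_plus; congr exp; ring.
have e1 : exp (- (lam * del)) <= 1.
  rewrite -exp_0; apply: exp_le; have := Rmult_le_pos _ _ lam0 del0; lra.
have q0 : 0 < / (K - 1) by apply: Rinv_0_lt_compat; lra.
have HE : (K * exp (- (lam * a)) - 1) / (K - 1) + / (K - 1) =
    K * exp (- (lam * a)) / (K - 1) by field; lra.
have Gdel : G (a + del) >= (K * exp (- (lam * (a + del))) - 1) / (K - 1).
  by apply: Rle_ge; apply: Rmax_r.
have Gdel0 : 0 <= G (a + del) by exact: Rmax_l.
have [le0|lt0] := Rle_lt_dec ((K * exp (- (lam * a)) - 1) / (K - 1)) 0.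
  have -> : G a = 0 by apply: Rmax_left.
  have : 0 <= (0 + / (K - 1)) * (1 - exp (- (lam * del))) by apply: Rmult_le_pos; lra.
  lra.
have -> : G a = (K * exp (- (lam * a)) - 1) / (K - 1) by apply: Rmax_right; lra.
apply: Rle_trans (_ : (K * exp (- (lam * a)) - 1) / (K - 1) -
  (K * exp (- (lam * (a + del))) - 1) / (K - 1) <= _); first lra.
rewrite HE eD; apply: Req_le; field; lra.
Qed.

(* For [k = 2] the exponential radius misses the constant 4 (its rate would give
   [a coth a > 1]), so the radius is uniform there; for [k >= 3] it is exponential
   of rate [4 ln k / Delta] truncated at [Delta / 2], where [k^-2] of the mass is cut. *)
Lemma radius_profile k Delta : (2 <= k)%nat -> 0 < Delta ->
  let beta := 4 * (ln (INR k) / ln 2) in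
  exists (G : R -> R) (q kap kap' : R),
    [/\ forall a b, a <= b -> G b <= G a, forall a, 0 <= G a, G 0 = 1
      & forall a, Delta / 2 < a -> G a = 0] /\
    [/\ 0 <= kap, 0 <= kap', kap + INR k * kap' <= beta / Delta
      & forall a del, 0 <= a -> 0 <= del ->
          G a - G (a + del) <= del * (kap * G a + kap')] /\
    [/\ 0 <= q, INR k * q <= 2
      & forall a, 0 <= a -> G a - G (a + Delta / beta) <= (G a + q) / 2].
Proof.
move=> k2 D0 beta.
have l2 : 0 < ln 2 by have := ln_lt_2; lra.
have iD : 0 < / Delta by apply: Rinv_0_lt_compat.
have max0 a b : a <= b -> Rmax 0 a <= Rmax 0 b.
  by move=> ab; apply: Rmax_lub; [apply: Rmax_l | apply: Rle_trans ab (Rmax_r _ _)].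
have [k_eq2|k_ne2] := eqVneq k 2%nat.
  have INR2 : INR 2 = 2 by rewrite /=; lra.
  have betaE : beta = 4 by rewrite /beta k_eq2 INR2; field; lra.
  have cut a del : 0 <= del -> Rmax 0 (1 - 2 * / Delta * a) -
      Rmax 0 (1 - 2 * / Delta * (a + del)) <= del * (2 * / Delta).
    move=> del0; have := Rmax_r 0 (1 - 2 * / Delta * (a + del)).
    have := Rmax_l 0 (1 - 2 * / Delta * (a + del)).
    have : 0 <= del * (2 * / Delta) by apply: Rmult_le_pos; lra.
    by move=> *; rewrite [X in X - _]/Rmax; case: Rle_dec => _; lra.
  (* Uniform on [[0, Delta / 2]]: two terminals of density [2 / Delta] use up all of
     [beta / Delta = 4 / Delta]. A length [Delta / 4] carries at most half of the mass, whence
     [q = 1]. *)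
  exists (fun r => Rmax 0 (1 - 2 * / Delta * r)), 1, 0, (2 * / Delta).
  split; [split|split; split]; rewrite ?betaE ?k_eq2 ?INR2.
  - move=> a b ab; apply: max0.
    have : 2 * / Delta * a <= 2 * / Delta * b by apply: Rmult_le_compat_l; lra.
    lra.
  - by move=> a; apply: Rmax_l.
  - by rewrite Rmult_0_r Rminus_0_r; apply: Rmax_right; lra.
  - move=> a Da; apply: Rmax_left.
    have := Rmult_lt_compat_l (2 * / Delta) _ _ ltac:(lra) Da.
    have -> : 2 * / Delta * (Delta / 2) = 1 by field; lra.
    lra.
  - lra.
  - lra.
  - lra.
  - by move=> a del a0 del0; have := cut a del del0; lra.
  - lra.
  - lra.
  - move=> a a0; have := cut a (Delta / 4) ltac:(lra).
    have -> : Delta / 4 * (2 * / Delta) = 1 / 2 by field; lra.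
    by have := Rmax_l 0 (1 - 2 * / Delta * a); lra.
have k3 : 3 <= INR k.
  have -> : 3 = INR 3 by rewrite /=; lra.
  by apply: le_INR; apply/leP; rewrite ltn_neqAle eq_sym k_ne2.
have lk : 0 < ln (INR k) by rewrite -ln_1; apply: ln_increasing; lra.
(* Chosen so that [K = exp (lam * (Delta / 2))], which makes the profile vanish beyond [Delta / 2],
   and [lam * (Delta / beta) = ln 2], which gives the factor 1/2. *)
set K := INR k * INR k; set lam := 4 * ln (INR k) * / Delta.
have K9 : 9 <= K by rewrite /K; nra.
have q0 : 0 < / (K - 1) by apply: Rinv_0_lt_compat; lra.
have lam0 : 0 < lam by apply: Rmult_lt_0_compat; lra.
(* Equality holds at [k = 3]. *)
have kq : INR k * / (K - 1) <= 3 / 8.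
  apply: (Rmult_le_reg_r (K - 1)); first lra.
  by rewrite Rmult_assoc Rinv_l; [rewrite /K; nra | lra].
pose G r := Rmax 0 ((K * exp (- (lam * r)) - 1) / (K - 1)).
have G0 a : 0 <= G a by apply: Rmax_l.
have cut a del : 0 <= del ->
    G a - G (a + del) <= (G a + / (K - 1)) * (1 - exp (- (lam * del))).
  by move=> del0; apply: exp_profile_cut; lra.
exists G, (/ (K - 1)), lam, (lam * / (K - 1)).
split; [split|split; split] => //; try lra.
- move=> a b ab; apply: max0; apply: Rmult_le_compat_r; first lra.
  have : exp (- (lam * b)) <= exp (- (lam * a)).
    by apply: exp_le; have := Rmult_le_compat_l lam _ _ ltac:(lra) ab; lra.
  by move=> /(Rmult_le_compat_l K _ _ ltac:(lra)); lra.
- rewrite /G Rmult_0_r Ropp_0 exp_0; have -> : (K * 1 - 1) / (K - 1) = 1 by field; lra.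
  by apply: Rmax_right; lra.
- move=> a Da; apply: Rmax_left.
  have : K * exp (- (lam * a)) <= 1.
    have KE : K = exp (lam * (Delta / 2)).
      have -> : lam * (Delta / 2) = ln (INR k) + ln (INR k) by rewrite /lam; field; lra.
      by rewrite exp_plus exp_ln //; lra.
    rewrite KE -exp_plus -exp_0; apply: exp_le.
    by have := Rmult_lt_compat_l lam _ _ lam0 Da; lra.
  by move=> le1; have := Rmult_le_pos _ _ (_ : 0 <= 1 - K * exp (- (lam * a)))
    (Rlt_le _ _ q0); rewrite /Rdiv; lra.
- by apply: Rmult_le_pos; lra.
- have -> : beta / Delta = lam * / ln 2 by rewrite /beta /lam; field; lra.
  have -> : lam + INR k * (lam * / (K - 1)) = lam * (1 + INR k * / (K - 1)) by ring.
  apply: Rmult_le_compat_l; first lra.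
  apply: (Rmult_le_reg_r (ln 2)) => //; rewrite Rinv_l; last lra.
  have := ln2_le; have : 0 <= ln 2 * (3 / 8 - INR k * / (K - 1)) by apply: Rmult_le_pos; lra.
  lra.
- move=> a del a0 del0; apply: Rle_trans (cut a del del0) _.
  have -> : del * (lam * G a + lam * / (K - 1)) = (G a + / (K - 1)) * (lam * del) by ring.
  apply: Rmult_le_compat_l; first by have := G0 a; lra.
  by have := exp_ineq1_le (- (lam * del)); lra.
- move=> a a0; have D'0 : 0 <= Delta / beta.
    apply: Rlt_le; apply: Rdiv_lt_0_compat => //.
    by rewrite /beta; have := Rdiv_lt_0_compat _ _ lk l2; lra.
  apply: Rle_trans (cut a _ D'0) _.
  have -> : exp (- (lam * (Delta / beta))) = / 2.
    have -> : lam * (Delta / beta) = ln 2 by rewrite /lam /beta; field; lra.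
    by rewrite exp_Ropp exp_ln; lra.
  by lra.
Qed.

(** * Tail bound for the number of clusters met by a shortest path *)

Lemma pow_ge_exp n r : r <= INR n -> exp (ln (3 / 2) * r) <= (3 / 2) ^ n.
Proof.
have l32 : 0 < ln (3 / 2) by rewrite -ln_1; apply: ln_increasing; lra.
move=> rn; rewrite -Rpower_pow; last lra.
apply: exp_le; rewrite Rmult_comm; apply: Rmult_le_compat_r; lra.
Qed.

Lemma pow_1plus_le_exp n x : 0 <= x -> (1 + x) ^ n <= exp (INR n * x).
Proof.
move=> x0; apply: Rle_trans (_ : exp x ^ n <= _).
  by apply: pow_incr; have := exp_ineq1_le x; lra.
by rewrite -Rpower_pow ?/Rpower ?ln_exp; [lra | apply: exp_pos].
Qed.

(* Markov's inequality for [(3/2) ^ hits (B i) Pi]: if more than [N t / 2] sets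
   are hit, some piece [B i] is hit by at least [t / 2] of them. *)
Lemma hits_markov (X : finType) N (A : {set X}) (B : 'I_N -> {set X}) Pi s t :
  A \subset \bigcup_i B i -> INR N * (t / 2) <= s ->
  indR (Defs.Rltb s (INR (hits A Pi))) <=
    exp (- (ln (3 / 2) / 2) * t) * \rsum_i ((3 / 2) ^ hits (B i) Pi).
Proof.
move=> sAB Ns; have e0 := exp_pos (- (ln (3 / 2) / 2) * t).
have pow0 i : 0 <= (3 / 2) ^ hits (B i) Pi by apply: pow_le; lra.
rewrite /Defs.Rltb; case: Rlt_dec => lt_s /=; last first.
  by apply: Rmult_le_pos; [lra | apply: rsum_ge0].
have [i ti] : exists i, t / 2 <= INR (hits (B i) Pi).
  apply: NNPP => Nex; have := hits_bigcup Pi sAB => /leP/le_INR.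
  rewrite (big_morph INR plus_INR (erefl (INR 0))) /= => le_hits.
  have : \rsum_i INR (hits (B i) Pi) <= \big[Rplus/0]_(i < N) (t / 2).
    apply: rsum_le => i _; apply: Rnot_lt_le => lt_t; apply: Nex; exists i; lra.
  by move=> /(Rle_trans _ _ _ le_hits); rewrite rsum_const card_ord; lra.
have := pow_ge_exp ti; rewrite (bigD1 i) //= => exp_le_pow.
set S := \big[Rplus/0]_(_ | _) _.
have S0 : 0 <= S by apply: rsum_ge0.
apply: Rle_trans (_ : exp (- (ln (3 / 2) / 2) * t) * exp (ln (3 / 2) * (t / 2)) <= _).
  rewrite -exp_plus; have -> : - (ln (3 / 2) / 2) * t + ln (3 / 2) * (t / 2) = 0 by field.
  by rewrite exp_0; lra.
by apply: Rmult_le_compat_l; lra.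
Qed.

(** In the generic case the path is cut into as many pieces as the ceiling says. Each has moment at
    most [3 * exp (3 / 2)], as [INR (size ts) * q <= 2], and Markov's inequality is summed over the
    pieces. In the two remaining cases the event is impossible. *)
Lemma shortest_path_hits_tail (X : finType) (d : X -> X -> R)
    (ball : X -> X -> {set X}) (w : X -> X -> R) (G : R -> R) beta Delta q
    (ts : seq X) x0 p t :
  is_metric d -> (forall a b, a <= b -> G b <= G a) -> (forall a, 0 <= G a) ->
  G 0 = 1 ->
  (forall u x y z, d u z <= d u y -> y \in ball u x -> z \in ball u x) ->
  (forall u x, u \in ball u x) -> (forall u x, 0 <= w u x) ->
  (forall u y, \rsum_(x | y \in ball u x) w u x = G (d u y)) ->
  4 <= beta -> 0 < Delta -> (0 < size ts)%nat ->
  0 <= q -> INR (size ts) * q <= 2 ->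
  (forall a, 0 <= a -> G a - G (a + Delta / beta) <= (G a + q) / 2) ->
  shortest_path d x0 p -> 1 <= t ->
  Ecarve ball w ts setT (fun Pi => indR (Defs.Rltb
      (t * beta / Delta * Rmax (sp_length d x0 p) (Delta / beta))
      (INR (Z_P x0 p Pi)))) <=
  3 * exp (3 / 2) * Rmin (INR (size ts) * beta) (Rceil (sp_length d x0 p * beta / Delta))
    * exp (- (ln (3 / 2) / 2) * t).
Proof.
move=> dM Gdecr Gge0 G0 ball_down ball_center w0 w_tail beta4 D0 k0 q0 kq Gcut sp t1.
have [d0 [d00 _]] := dM.
have wsum1 := weights_sum1 dM G0 ball_center w_tail.
set D := sp_length d x0 p; set A := [set:: x0 :: p].
have Dge0 : 0 <= D by apply: d0.
have bD : 0 < beta / Delta by apply: Rdiv_lt_0_compat; lra.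
have iD : 0 < Delta / beta by apply: Rdiv_lt_0_compat; lra.
have bDK : beta / Delta * (Delta / beta) = 1 by field; lra.
have -> : D * beta / Delta = beta / Delta * D by rewrite /Rdiv; ring.
set m := beta / Delta * D; set s := t * beta / Delta * Rmax D (Delta / beta).
have m0 : 0 <= m by apply: Rmult_le_pos; lra.
have sE : s = t * (beta / Delta * Rmax D (Delta / beta)) by rewrite /s /Rdiv; ring.
have s_m : t * m <= s.
  rewrite sE; apply: Rmult_le_compat_l; first lra.
  by apply: Rmult_le_compat_l; [lra | apply: Rmax_l].
have s_t : t <= s.
  rewrite sE -[X in X <= _]Rmult_1_r -bDK; apply: Rmult_le_compat_l; first lra.
  by apply: Rmult_le_compat_l; [lra | apply: Rmax_r].
have k1 : 1 <= INR (size ts) by rewrite -/(INR 1); apply: le_INR; apply/leP.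
have [m_ceil ceil_m] := Rceil_bound m.
have kb : 4 * INR (size ts) <= INR (size ts) * beta by nra.
have e0 := exp_pos (- (ln (3 / 2) / 2) * t); have e32 := exp_pos (3 / 2).
have zero : (forall Pi, carved ball ts setT Pi -> INR (hits A Pi) <= s) ->
    Ecarve ball w ts setT (fun Pi => indR (Defs.Rltb s (INR (Z_P x0 p Pi)))) <=
    3 * exp (3 / 2) * Rmin (INR (size ts) * beta) (Rceil m)
      * exp (- (ln (3 / 2) / 2) * t).
  move=> hits_s; apply: Rle_trans (_ : 0 <= _).
    rewrite -[X in _ <= X](Ecarve_const ball wsum1 ts setT).
    apply: Ecarve_le => // Pi /hits_s; rewrite Z_P_hits -/A /Defs.Rltb.
    by case: Rlt_dec => /=; lra.
  apply: Rmult_le_pos; last lra.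
  apply: Rmult_le_pos; first lra.
  by apply: Rmin_glb; lra.
(* If the ceiling exceeds [INR (size ts) * beta], then [m > 4 * INR (size ts) - 1], so the threshold
   [s >= m] is at least the number of clusters. *)
have [lt_ceil|le_ceil] := Rlt_le_dec (INR (size ts) * beta) (Rceil m).
  apply: zero => Pi /carved_card cardPi.
  have /leP/le_INR := leq_trans (hits_card A Pi) cardPi.
  have : 1 * m <= t * m by apply: Rmult_le_compat_r.
  lra.
(* At length zero the ceiling is 0; one cluster at most is met, while [s >= t >= 1]. *)
have [Dpos|Dzero] := Rle_lt_or_eq_dec _ _ Dge0; last first.
  apply: zero => Pi cPi; suff -> : A = [set x0].
    by have /leP/le_INR := carved_hits1 x0 cPi; rewrite /=; lra.
  apply/setP => y; rewrite in_set in_set1; apply/idP/eqP => [yp|->]; last exact: mem_head.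
  symmetry; apply/d00; have := shortest_path_le dM sp yp.
  by rewrite -/D; have := d0 x0 y; lra.
rewrite Rmin_right //.
have mpos : 0 < m by apply: Rmult_lt_0_compat.
have [N NE] := Rceil_INR m0.
have N0 : (0 < N)%nat.
  by rewrite lt0n; apply/eqP => N0; move: m_ceil; rewrite NE N0 /=; lra.
(* Distance from [x0] in units of [Delta / beta]; [B i] is the part of the path in the i-th unit
   segment. *)
pose pos y := beta / Delta * d x0 y.
pose B (i : 'I_N) := [set y | (y \in x0 :: p) &&
  (Rleb (INR i) (pos y) && Rleb (pos y) (INR i + 1))].
have sAB : A \subset \bigcup_i B i.
  apply/subsetP => y; rewrite inE => yp.
  have [|i [ri1 ri2]] := @unit_segment N (pos y) N0.
    split; first by apply: Rmult_le_pos; [lra | apply: d0].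
    rewrite -NE; apply: Rle_trans m_ceil; apply: Rmult_le_compat_l; first lra.
    exact: shortest_path_le.
  apply/bigcupP; exists i => //; rewrite in_set yp /=.
  by apply/andP; split; apply/RlebP.
have diamB i x y : x \in B i -> y \in B i -> d x y <= Delta / beta.
  rewrite !in_set => /andP[xp /andP[/RlebP x1 /RlebP x2]] /andP[yp /andP[/RlebP y1 /RlebP y2]].
  rewrite (shortest_path_isometric dM sp xp yp).
  apply: (Rmult_le_reg_l (beta / Delta)) => //; rewrite bDK.
  rewrite -[X in X * _]Rabs_pos_eq; last lra.
  rewrite -Rabs_mult; apply: Rabs_le; move: x1 x2 y1 y2; rewrite /pos; lra.
(* Since [N < m + 1] and both [t * m] and [t] are at most [s]. This loss of a factor 2 is why the
   rate is [ln (3 / 2) / 2]. *)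
have NtS : INR N * (t / 2) <= s.
  rewrite -NE; have : (Rceil m) * t <= (m + 1) * t by apply: Rmult_le_compat_r; lra.
  lra.
apply: Rle_trans (_ : Ecarve ball w ts setT (fun Pi =>
    exp (- (ln (3 / 2) / 2) * t) * \rsum_i ((3 / 2) ^ hits (B i) Pi)) <= _).
  by apply: Ecarve_le => // Pi _; rewrite Z_P_hits; apply: hits_markov.
rewrite EcarveZ Ecarve_sum Rmult_comm; apply: Rmult_le_compat_r; first lra.
rewrite NE -[N in INR N]card_ord -Rmult_comm -rsum_const; apply: rsum_le => i _.
have := hits_moment_bound dM Gdecr Gge0 G0 ball_down ball_center w0 w_tail
  ts setT q0 (diamB i) Gcut.
move=> /Rle_trans; apply; apply: Rmult_le_compat_l; first lra.
apply: Rle_trans (pow_1plus_le_exp _ _) _; first lra.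
by apply: exp_le; lra.
Qed.

(** * Assembly of the decomposition *)

Lemma terminal_decomposable (X : finType) (d : X -> X -> R) (T : {set X}) :
  is_metric d -> (2 <= #|T|)%nat ->
  terminal_decomposable_with_concentration_consts d T
    (4 * (ln (INR #|T|) / ln 2)) (3 * exp (3 / 2)) (ln (3 / 2) / 2).
Proof.
move=> dM k2 Delta D0.
have [d0 [d00 [dC dT]]] := dM.
have dxx u : d u u = 0 by apply/d00.
have [G [q [kap [kap' [[Gdecr Gge0 G0 GM] [[kap0 kap'0 kapE cut] [q0 kq half]]]]]]] :=
  radius_profile k2 D0.
have beta4 := four_log2_ge4 k2.
set beta := 4 * (_ / _) in kapE half beta4 *.
set k := #|T| in k2 kapE kq *.
have [w w0 wE] := fin_all_exists2 (fun t => exists_tail_weights (d t) Gdecr Gge0).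
(* The cap at [Delta / 2] bounds the diameter for every [x], whatever its weight. It leaves the
   tails unchanged because [G] vanishes beyond [Delta / 2]. *)
pose ball t x := [set y | Rleb (d t y) (d t x) && Rleb (d t y) (Delta / 2)].
have ball_down u x y z : d u z <= d u y -> y \in ball u x -> z \in ball u x.
  rewrite !inE => zy /andP[/RlebP yx /RlebP yD].
  by apply/andP; split; apply/RlebP; lra.
have ball_center u x : u \in ball u x.
  by rewrite inE dxx; apply/andP; split; apply/RlebP; [apply: d0 | lra].
have w_tail u y : \rsum_(x | y \in ball u x) w u x = G (d u y).
  have [le_yD|lt_Dy] := Rle_lt_dec (d u y) (Delta / 2).
    rewrite -wE; apply: eq_bigl => x; rewrite inE.
    by have /RlebP-> := le_yD; rewrite andbT.
  rewrite GM // big_pred0 // => x; rewrite inE.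
  by apply/andP => -[_ /RlebP]; lra.
have wsum1 := weights_sum1 dM G0 ball_center w_tail.
pose ts := enum T; have tsE : size ts = k by rewrite /ts -cardE.
exists (carve_dist ball w ts); split; [|split; [|split; [|split; [|split]]]].
- exact: carve_distP.
- by move=> Pi /(carve_dist_supp w0 wsum1)/carved_trivIset.
- move=> Pi /(carve_dist_supp w0 wsum1) cPi S SPi x y xS yS.
  have [t [z /subsetP sub]] := carved_sub_ball cPi SPi.
  move: (sub _ xS) (sub _ yS); rewrite !inE => /andP[_ /RlebP tx] /andP[_ /RlebP ty].
  by have := dT x t y; rewrite (dC x t); lra.
- move=> x y; rewrite prob_carve_dist //.
  apply: Rle_trans (separation_bound dM Gdecr Gge0 G0 ball_down ball_center w0 w_tail
    (kap := d x y * kap) (kap' := d x y * kap') _ _ _ _ _ _) _.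
  + exact: Rmult_le_pos.
  + exact: Rmult_le_pos.
  + by move=> a a0; apply: Rle_trans (cut a (d x y) a0 (d0 x y)) _; lra.
  + by rewrite inE.
  + by rewrite inE.
  rewrite tsE; have := Rmult_le_compat_l _ _ _ (d0 x y) kapE; rewrite /Rdiv; lra.
- move=> Pi /(carve_dist_supp w0 wsum1) cPi; apply/subsetP => t tT.
  by apply: (carved_cover (ball_center t) cPi); rewrite ?mem_enum ?inE.
- move=> x0 p sp t t1; rewrite prob_carve_dist // -tsE.
  apply: (shortest_path_hits_tail dM Gdecr Gge0 G0 ball_down ball_center w0 w_tail
    (q := q)) => //.
  + by rewrite tsE; apply: leq_trans k2.
  + by rewrite tsE.
Qed.

Local Close Scope R_scope.

(* log k is read as log base 2: log2 k = ln k / ln 2.  The constants C, c are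
   absolute: chosen before X, d, T (and Delta). *)
Theorem theorem3 :
  exists C c : R, (0 < C)%R /\ (0 < c)%R /\
  forall (X : finType) (d : X -> X -> R) (T : {set X}),
    is_metric d -> (2 <= #|T|)%N ->
    terminal_decomposable_with_concentration_consts d T
      (4 * (ln (INR #|T|) / ln 2))%R C c.
Proof.
exists (3 * exp (3 / 2))%R, (ln (3 / 2) / 2)%R.
have e0 := exp_pos (3 / 2)%R.
have l0 : (0 < ln (3 / 2))%R by rewrite -ln_1; apply: ln_increasing; lra.
by split; [lra | split; [lra | exact: terminal_decomposable]].
Qed.
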